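(* Maker has a winning strategy in the $K^{\mathbb{Q}}$-building game.
   Context: Let $K^{\mathbb{Q}}$ denote the complete graph whose vertex set is the set $\mathbb{Q}$ of rational numbers; it is called the board. In the $K^{\mathbb{Q}}$-building game, two players, Maker and Breaker, take turns alternately, Maker first. In each turn the player claims one previously unclaimed edge of the board (colours it in her/his colour). The game lasts countably many (i.e. $\omega$ many) turns. Let $G_M$ be the graph formed by all edges Maker has claimed during the whole game. Maker wins if there is a set $Q \subseteq \mathbb{Q}$ such that $(Q,\le)$, with the order inherited from the usual order on $\mathbb{Q}$, is order-isomorphic to $(\mathbb{Q},\le)$ and every edge between two distinct vertices of $Q$ belongs to $G_M$ (i.e. $G_M$ contains a complete graph on $Q$). Otherwise Breaker wins. A winning strategy for Maker is a strategy guaranteeing Maker wins regardless of Breaker's moves. *)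

(* Defs.v *)
From mathcomp Require Import all_boot all_order all_algebra.
Set Implicit Arguments. Unset Strict Implicit. Unset Printing Implicit Defensive.
Import Order.TTheory GRing.Theory Num.Theory.
Local Open Scope ring_scope.

(* An edge of the board K^Q is an unordered pair {x,y} of distinct rationals,
   represented canonically as the ordered pair (x, y) with x < y. *)
Definition edge := (rat * rat)%type.
Definition is_edge (e : edge) : Prop := e.1 < e.2.

(* A play is the infinite sequence of claimed edges: turn n (n = 0,1,2,...)
   is Maker's if n is even, Breaker's if n is odd. *)
Definition play := nat -> edge.

Definition history (p : play) (n : nat) : seq edge := [seq p i | i <- iota 0 n].

Definition maker_strategy := seq edge -> edge.

Definition follows (s : maker_strategy) (p : play) : Prop :=
  forall n, ~~ odd n -> p n = s (history p n).

Definition legal_move (p : play) (n : nat) : Prop :=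
  is_edge (p n) /\ forall i, (i < n)%N -> p i <> p n.

Definition maker_edge (p : play) (x y : rat) : Prop :=
  exists n, ~~ odd n /\ p n = (x, y).

Definition maker_wins (p : play) : Prop :=
  exists (Q : rat -> Prop) (f : rat -> rat),
    (forall a b, a < b -> f a < f b) /\
    (forall q, Q q <-> exists a, f a = q) /\
    (forall x y, Q x -> Q y -> x < y -> maker_edge p x y).

Definition winning_maker_strategy (s : maker_strategy) : Prop :=
  forall p : play, follows s p ->
    (forall n, odd n -> legal_move p n) ->
    (forall n, ~~ odd n -> legal_move p n) /\ maker_wins p.

(* Main.v *)
(* Maker grows a tree of vertices in which every vertex is joined by Maker's edges
   to all its ancestors.  The n-th inserted vertex w is a fresh rational just to the
   right of its "type" x_n, every rational being the type of infinitely many w.  It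
   is joined to the root and then walks down the tree.  Standing at a vertex of depth
   d, it is given as aim a set of about 2d children, one of which Breaker cannot have
   separated from w, and moves there; or it stops and becomes a new child.  For every
   tree vertex c and type x, the successive arrivals at c of type x run through all
   aims, each infinitely often.

   Let X_c be the set of types arriving infinitely often at c.  If y is in X_c, then c
   has infinitely many children close to y, and every x in X_c lies in X_s for all but
   a bounded number of children s of c.  Call a set of rationals rich if it contains a
   copy of Q; a rich set covered by finitely many sets has a rich one among them.
   Hence, given finitely many gaps in which X_c is rich, some child s close to y has
   X_s rich in all of them.  Splitting a gap at such an s, again and again along a
   branch starting from X_root = Q, yields a copy of Q inside that branch. *)
Require Import Defs.
From mathcomp Require Import all_boot all_order all_algebra.
From mathcomp Require Import boolp lra.
Set Implicit Arguments. Unset Strict Implicit. Unset Printing Implicit Defensive.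
Import Order.TTheory GRing.Theory Num.Theory.
Local Open Scope ring_scope.

(** * Edges at a vertex and a pigeonhole bound *)

Definition mkedge (a b : rat) : edge := if a < b then (a, b) else (b, a).

Lemma mkedgeC a b : mkedge a b = mkedge b a.
Proof. by rewrite /mkedge; case: (ltgtP a b) => // ->. Qed.

Lemma mkedge_lt a b : a < b -> mkedge a b = (a, b).
Proof. by rewrite /mkedge => ->. Qed.

Lemma is_edge_mkedge a b : a != b -> is_edge (mkedge a b).
Proof. by rewrite /is_edge /mkedge; case: (ltgtP a b). Qed.

Definition incident (w : rat) (e : edge) : bool := (e.1 == w) || (e.2 == w).

Lemma incident_mkedge w s : incident w (mkedge w s).
Proof. by rewrite /incident /mkedge; case: ifP => _ /=; rewrite eqxx ?orbT. Qed.

Lemma mkedge_inj w : injective (mkedge w).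
Proof.
move=> s t; rewrite /mkedge.
case: (ltgtP w s) => [ws|sw|<-]; case: (ltgtP w t) => [wt|tw|<-] // [] *;
  by subst; (reflexivity || lra).
Qed.

(** [mkedge w] is injective, so if every element of [A] were blocked, [h] would contain more than
    [n] distinct edges at [w]. Hence [head] returns a genuine member and never its default. *)
Lemma head_unblocked w (A : seq rat) (h : seq edge) n :
  uniq A -> (n < size A)%N -> (count (incident w) h <= n)%N ->
  head 0 [seq s <- A | mkedge w s \notin h]
    \in [seq s <- A | mkedge w s \notin h].
Proof.
move=> uA nA cnt; have : has (fun s => mkedge w s \notin h) A.
  apply/negPn/negP => /hasPn nS.
  have sub : {subset map (mkedge w) A <= filter (incident w) h}.
    move=> _ /mapP[t /nS + ->]; rewrite negbK mem_filter => ->.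
    by rewrite incident_mkedge.
  have := uniq_leq_size (_ : uniq (map (mkedge w) A)) sub.
  rewrite (map_inj_uniq (@mkedge_inj w)) uA size_map size_filter => /(_ isT).
  by move=> /(leq_trans nA)/leq_trans/(_ cnt); rewrite ltnn.
by rewrite has_filter; case: (filter _ _) => // t A' _; rewrite mem_head.
Qed.

Lemma ex_notin (T : eqType) (f : nat -> T) (F : seq T) :
  injective f -> has (fun i => f i \notin F) (iota 0 (size F).+1).
Proof.
move=> finj; apply/negPn/negP => /hasPn nF.
have sub : {subset map f (iota 0 (size F).+1) <= F}.
  by move=> _ /mapP[i /nF + ->]; rewrite negbK.
have := uniq_leq_size (_ : uniq (map f (iota 0 (size F).+1))) sub.
by rewrite (map_inj_uniq finj) iota_uniq size_map size_iota ltnn => /(_ isT).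
Qed.

(** * Fresh vertices just to the right of a type *)

Definition near_right (x : rat) (n i : nat) : rat := x + (n + i).+1%:R^-1.

(** Among [(size F).+1] distinct candidates one avoids [F], so the search succeeds; a larger [n]
    forces the result closer to [x]. *)
Definition fresh (x : rat) (n : nat) (F : seq rat) : rat :=
  near_right x n (find (fun i => near_right x n i \notin F) (iota 0 (size F).+1)).

Lemma near_right_inj x n : injective (near_right x n).
Proof.
move=> i j /addrI /invr_inj /eqP; rewrite eqr_nat eqSS eqn_add2l.
by move/eqP.
Qed.

Lemma fresh_notin x n F : fresh x n F \notin F.
Proof.
have hF := ex_notin F (@near_right_inj x n).
have := nth_find 0%N hF; rewrite nth_iota ?add0n //.
by move: hF; rewrite has_find size_iota.
Qed.

Lemma fresh_gt x n F : x < fresh x n F.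
Proof. by rewrite ltrDl invr_gt0 ltr0n. Qed.

Lemma fresh_le x n F : fresh x n F <= x + n.+1%:R^-1.
Proof. by rewrite lerD2l lef_pV2 ?posrE ?ltr0n // ler_nat ltnS leq_addr. Qed.

Definition vertices (h : seq edge) : seq rat := unzip1 h ++ unzip2 h.

Lemma incident_vertices w h : w \notin vertices h -> count (incident w) h = 0%N.
Proof.
move=> wh; apply/eqP; rewrite -leqn0 leqNgt -has_count; apply: contra wh.
case/hasP=> e eh; rewrite /vertices mem_cat => /orP[] /eqP <-.
  by rewrite map_f.
by rewrite orbC map_f.
Qed.

(* Enumerations in which every type, resp. every aim, occurs infinitely often. *)
Definition type_of (n : nat) : rat :=
  if @unpickle (rat * nat)%type n is Some (x, _) then x else 0.
Definition aim_of (m : nat) : seq rat :=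
  if @unpickle (seq rat * nat)%type m is Some (A, _) then A else [::].

Lemma pickle_unbounded (T : countType) (x : T) N :
  exists k, (N <= @pickle (T * nat)%type (x, k))%N.
Proof.
have inj : injective (fun k : nat => @pickle (T * nat)%type (x, k)).
  by move=> i j /(pcan_inj pickleK)[].
have /hasP[k _ kN] := ex_notin (iota 0 N) inj.
by exists k; rewrite leqNgt; apply: contra kN; rewrite mem_iota.
Qed.

Lemma type_of_often x N : exists2 n, (N <= n)%N & type_of n = x.
Proof.
have [k ?] := pickle_unbounded x N; exists (pickle (x, k)) => //.
by rewrite /type_of pickleK.
Qed.

Lemma aim_of_often S N : exists2 m, (N <= m)%N & aim_of m = S.
Proof.
have [k ?] := pickle_unbounded S N; exists (pickle (S, k)) => //.
by rewrite /aim_of pickleK.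
Qed.

(** * Maker's strategy *)

(* A tree vertex is encoded by its path, from the vertex itself up to the root.
   [walker] holds the type of the vertex being inserted, that vertex, the path it
   has reached, and the children of that path among which it has to continue. *)
Record state := State {
  launches : nat;
  arrivals : seq (rat * seq rat);
  tree : seq (seq rat);
  walker : option (rat * rat * seq rat * seq rat) }.

Definition init : state := State 0 [::] [::] None.
Definition root : rat := 0.

Record walk := Walk { wtype : rat; wvertex : rat; wpath : seq rat; wtarget : rat }.

Definition next_walk (st : state) (h : seq edge) : walk :=
  if walker st is Some (x, w, p, A) then
    Walk x w p (head 0 [seq s <- A | mkedge w s \notin h])
  else
    let x := type_of (launches st) in
    Walk x (fresh x (launches st) (root :: flatten (tree st) ++ vertices h))
      [::] root.

Definition move (st : state) (h : seq edge) : edge :=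
  let k := next_walk st h in mkedge (wvertex k) (wtarget k).

(* Since a walker was fresh at its launch, at most [2 |p|] edges at it are claimed
   when it has reached the path [p]: one of [2 |p| + 1] children is available. *)
Definition valid_aim (T : seq (seq rat)) (p S : seq rat) : bool :=
  [&& uniq S, size S == (size p).*2.+1 & all (fun s => (s :: p) \in T) S].

Definition reached (k : walk) : seq rat := wtarget k :: wpath k.

(** Arrivals of one type at one path are numbered separately, so each such pair runs through the
    whole enumeration [aim_of] at its own pace. *)
Definition next_aim (st : state) (k : walk) : seq rat :=
  aim_of (count_mem (wtype k, reached k) (arrivals st)).

Definition step (st : state) (h : seq edge) : state :=
  let k := next_walk st h in
  let S := next_aim st k in
  let b := valid_aim (tree st) (reached k) S in
  State (if walker st is None then (launches st).+1 else launches st)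
    ((wtype k, reached k) :: arrivals st)
    (if b then tree st else (wvertex k :: reached k) :: tree st)
    (if b then Some (wtype k, wvertex k, reached k, S) else None).

(** A strategy sees only the history, so the state is replayed from the prefixes of even length, the
    positions in which Maker was to move. *)
Fixpoint state_after (h : seq edge) (k : nat) : state :=
  if k is k'.+1 then step (state_after h k') (take k'.*2 h) else init.

Definition strategy : maker_strategy :=
  fun h => move (state_after h (size h)./2) h.

Fixpoint states (p : play) (k : nat) : state :=
  if k is k'.+1 then step (states p k') (history p k'.*2) else init.

Lemma size_history p n : size (history p n) = n.
Proof. by rewrite size_map size_iota. Qed.

Lemma take_history p m n : (m <= n)%N -> take m (history p n) = history p m.
Proof. by move=> mn; rewrite /history -map_take take_iota (minn_idPl mn). Qed.

Lemma state_after_history p k n :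
  (k.*2 <= n)%N -> state_after (history p n) k = states p k.
Proof.
elim: k => [//|k IH kn].
have kn' : (k.*2 <= n)%N by rewrite (leq_trans _ kn) // doubleS -addn2 leq_addr.
have -> : state_after (history p n) k.+1 =
  step (state_after (history p n) k) (take k.*2 (history p n)) by [].
by rewrite (IH kn') (take_history p kn').
Qed.

(** * Rich sets of rationals *)

(* A set of rationals is rich when it contains a dense order with two points,
   equivalently a copy of the rationals. *)
Definition rich (P : rat -> Prop) := exists D : rat -> Prop,
  [/\ forall x, D x -> P x, exists a b, [/\ D a, D b & a < b] &
      forall a b, D a -> D b -> a < b -> exists2 c, D c & a < c < b].

Lemma rich_sub (P Q : rat -> Prop) : (forall x, P x -> Q x) -> rich P -> rich Q.
Proof. by move=> PQ [D [DP ? ?]]; exists D; split => // x /DP/PQ. Qed.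

(** Either [A] meets [D] between any two points of [D], and [D] restricted to [A] is dense, or some
    interval of [D] avoids [A] and thus lies in [B]. *)
Lemma rich_cover2 (P A B : rat -> Prop) :
  rich P -> (forall x, P x -> A x \/ B x) -> rich A \/ rich B.
Proof.
move=> [D [DP [a0 [b0 [Da0 Db0 ab0]]] dense]] PAB.
have [[a [b [Da Db ab nA]]]|nex] := pselect (exists a b,
    [/\ D a, D b, a < b & forall c, D c -> a < c < b -> ~ A c]).
  right; exists (fun x => D x /\ a < x < b); split.
  - by move=> x [Dx xab]; case: (PAB x (DP x Dx)) => // /(nA _ Dx xab).
  - have [c Dc /andP[ac cb]] := dense _ _ Da Db ab.
    have [d Dd /andP[ad dc]] := dense _ _ Da Dc ac.
    by exists d, c; rewrite ac cb ad (lt_trans dc cb).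
  - move=> u v [Du /andP[au ub]] [Dv /andP[av vb]] uv.
    have [c Dc /andP[uc cv]] := dense _ _ Du Dv uv.
    by exists c; rewrite ?uc ?cv // (lt_trans au uc) (lt_trans cv vb).
left; exists (fun x => D x /\ A x).
have denseA a b : D a -> D b -> a < b -> exists2 c, D c /\ A c & a < c < b.
  move=> Da Db ab; apply: contrapT => nc; apply: nex; exists a, b; split => //.
  by move=> c Dc acb Ac; apply: nc; exists c.
split; first by move=> x [].
  have [c [Dc Ac] /andP[ac cb]] := denseA _ _ Da0 Db0 ab0.
  have [d [Dd Ad] /andP[ad dc]] := denseA _ _ Da0 Dc ac.
  by exists d, c.
by move=> a b [Da _] [Db _]; apply: denseA.
Qed.

Lemma rich_cover (T : eqType) (A : seq T) (P : T -> rat -> Prop) (Q : rat -> Prop) :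
  rich Q -> (forall x, Q x -> exists2 s, s \in A & P s x) ->
  exists2 s, s \in A & rich (P s).
Proof.
elim: A Q => [|a A IH] Q rQ cov.
  have [D [DQ [x [b [Dx _ _]]] _]] := rQ.
  by have [] := cov x (DQ x Dx).
have [||r|r] := @rich_cover2 Q (P a) (fun x => exists2 s, s \in A & P s x) => //.
- move=> x /cov[s]; rewrite inE => /orP[/eqP->|]; first by left.
  by right; exists s.
- by exists a; rewrite ?mem_head.
- by have [//|s sA rs] := IH _ r; exists s; rewrite // inE sA orbT.
Qed.

(** The space between [y] and [b] is reserved for a new vertex of type [y]: wherever it falls there,
    both sides of it stay rich. *)
Lemma rich_split (X : rat -> Prop) u v :
  rich (fun x => X x /\ u < x < v) -> exists y b,
    [/\ X y, u < y < b, b < v, rich (fun x => X x /\ u < x < y) &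
        rich (fun x => X x /\ b < x < v)].
Proof.
move=> [D [DX [a [c [Da Dc ac]]] dense]].
have [y Dy /andP[ay yc]] := dense _ _ Da Dc ac.
have [b Db /andP[yb bc]] := dense _ _ Dy Dc yc.
have [Xa /andP[ua av]] := DX _ Da; have [Xc /andP[uc cv]] := DX _ Dc.
have [Xy /andP[uy yv]] := DX _ Dy; have [Xb /andP[ub bv]] := DX _ Db.
exists y, b; split; rewrite ?uy //.
  exists (fun x => D x /\ a <= x < y); split.
  - move=> x [Dx /andP[ax ->]]; rewrite (lt_le_trans ua ax).
    by case: (DX _ Dx).
  - have [d Dd /andP[ad dy]] := dense _ _ Da Dy ay.
    by exists a, d; rewrite lexx ay ltW.
  - move=> s t [Ds /andP[ls rs]] [Dt /andP[lt rt]] st.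
    have [d Dd /andP[sd dt]] := dense _ _ Ds Dt st.
    exists d; rewrite ?sd //; split => //.
    by rewrite (le_trans ls (ltW sd)) (lt_trans dt rt).
exists (fun x => D x /\ b < x <= c); split.
- move=> x [Dx /andP[bx xc]]; rewrite bx (le_lt_trans xc cv).
  by case: (DX _ Dx).
- have [d Dd /andP[bd dc]] := dense _ _ Db Dc bc.
  by exists d, c; rewrite lexx bd bc ltW.
- move=> s t [Ds /andP[ls rs]] [Dt /andP[lt rt]] st.
  have [d Dd /andP[sd dt]] := dense _ _ Ds Dt st.
  exists d; rewrite ?sd //; split => //.
  by rewrite (lt_trans ls sd) (le_trans (ltW dt) rt).
Qed.

Lemma rich_interval (X : rat -> Prop) u v : u < v ->
  (forall x, X x) -> rich (fun x => X x /\ u < x < v).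
Proof.
move=> uv allX; exists (fun x => u < x < v); split => //.
  by exists ((2 * u + v) / 3), ((u + v) / 2); split; lra.
by move=> a b ? ? ?; exists ((a + b) / 2); lra.
Qed.

Lemma seq_argmax (T : eqType) (f : T -> rat) (L : seq T) a0 : a0 \in L ->
  exists2 m, m \in L & forall a, a \in L -> f a <= f m.
Proof.
elim: L a0 => [//|a L IH] _ _; case: L IH => [|b L] IH.
  by exists a; rewrite ?mem_head // => c; rewrite inE => /eqP->.
have [m mL mM] := IH b (mem_head _ _).
have [le|lt] := leP (f m) (f a).
  exists a; rewrite ?mem_head // => c; rewrite inE => /orP[/eqP-> //|/mM cm].
  exact: le_trans le.
exists m; first by rewrite inE mL orbT.
by move=> c; rewrite inE => /orP[/eqP->|/mM //]; apply: ltW.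
Qed.

(** An order embedding of the rationals into the open unit interval, which leaves 0 and 1 free to
    serve as sentinels. *)
Definition squash (x : rat) : rat :=
  if 0 <= x then 1 - (2 * (1 + x))^-1 else (2 * (1 - x))^-1.

Lemma squash_bounds x : 0 < squash x < 1.
Proof.
have half (y : rat) : 0 <= y -> 0 < (2 * (1 + y))^-1 <= 2^-1.
  move=> y0; rewrite invr_gt0 lef_pV2 ?posrE; lra.
rewrite /squash; case: (leP 0 x) => x0.
  by have := half _ x0; lra.
by have := half (- x); lra.
Qed.

Lemma squash_lt x y : x < y -> squash x < squash y.
Proof.
move=> xy; rewrite /squash; case: (leP 0 x) => x0; case: (leP 0 y) => y0.
- by rewrite ltrD2l ltrN2 ltf_pV2 ?posrE; lra.
- lra.
- have : (2 * (1 - x))^-1 < 2^-1 by rewrite ltf_pV2 ?posrE; lra.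
  have : (2 * (1 + y))^-1 <= 2^-1 by rewrite lef_pV2 ?posrE; lra.
  lra.
- by rewrite ltf_pV2 ?posrE; lra.
Qed.

(** * Invariants of a play that follows the strategy *)

Section Play.
Variable p : play.
Hypothesis fp : follows strategy p.

Let st k := states p k.
Let hist k := history p k.*2.
Let wk k := next_walk (st k) (hist k).

Lemma maker_moveE k : p k.*2 = mkedge (wvertex (wk k)) (wtarget (wk k)).
Proof.
rewrite fp ?odd_double // /strategy size_history doubleK.
by rewrite state_after_history.
Qed.

Definition adjacent u v := exists k, p k.*2 = mkedge u v.

Lemma adjacentC u v : adjacent u v -> adjacent v u.
Proof. by case=> k e; exists k; rewrite mkedgeC. Qed.

Definition clique (t : seq rat) :=
  {in t &, forall u v, u != v -> adjacent u v}.

Lemma clique_cons w t :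
  clique t -> {in t, forall u, adjacent w u} -> clique (w :: t).
Proof.
move=> ct wt u v; rewrite !inE => /orP[/eqP->|ut] /orP[/eqP->|vt] uv.
- by rewrite eqxx in uv.
- exact: wt.
- exact/adjacentC/wt.
- exact: ct.
Qed.

Definition good_walker (s : state) (h : seq edge) :=
  if walker s is Some (x, w, q, A) then
    [/\ [/\ clique q, {in q, forall u, adjacent w u} & w \notin flatten (tree s)],
        valid_aim (tree s) q A,
        (count (incident w) h <= (size q).*2)%N &
        x < w <= x + (launches s)%:R^-1]
  else True.

(** [launches] is read after the step because launch number [n] places its vertex within 1/(n+1) of
    its type. *)
Definition good_walk (s : state) (h : seq edge) (k : walk) :=
  [/\ clique (reached k) /\ {in wpath k, forall u, adjacent (wvertex k) u},
      wvertex k \notin flatten (tree s),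
      (count (incident (wvertex k)) h <= (size (wpath k)).*2)%N,
      mkedge (wvertex k) (wtarget k) \notin h /\ wvertex k != wtarget k &
      wtype k < wvertex k <= wtype k + (launches (step s h))%:R^-1].

Lemma good_next_walk s h :
  (forall t, t \in tree s -> clique t) -> good_walker s h ->
  good_walk s h (next_walk s h).
Proof.
move=> cT; rewrite /good_walker /good_walk /step /next_walk /reached.
case: (walker s) => [[[[x w] q] A]|] /=; last first.
  move=> _; set F := root :: _ ++ _; set w := fresh _ _ _.
  have /negP wF : w \notin F by apply: fresh_notin.
  have wV : w \notin vertices h.
    by apply/negP => wv; case: wF; rewrite inE mem_cat wv !orbT.
  split.
  - by split=> // u v; rewrite !inE => /eqP-> /eqP->; rewrite eqxx.
  - by apply/negP => wv; case: wF; rewrite inE mem_cat wv !orbT.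
  - by rewrite incident_vertices.
  - split; last by apply/eqP => wr; case: wF; rewrite wr inE eqxx.
    apply/negP => eh; have := incident_vertices wV; apply/eqP.
    rewrite -lt0n -has_count; apply/hasP; exists (mkedge w root) => //.
    exact: incident_mkedge.
  - by rewrite fresh_gt fresh_le.
case=> [[cq aq wT] /and3P[uA /eqP sA /allP AT] cnt xw].
have := @head_unblocked w A h (size q).*2 uA _ cnt; rewrite sA ltnSn => /(_ isT).
set t := head _ _ => /=.
rewrite mem_filter => /andP[th tA]; have tT := AT _ tA.
split => //; first by split=> //; apply: cT tT.
(* The target lies in the tree and the walking vertex does not, so they differ. *)
split=> //; apply: contraNneq wT => ->; apply/flattenP.
by exists (t :: q) => //; rewrite mem_head.
Qed.

Definition good k :=
  (forall t, t \in tree (st k) -> clique t) /\ good_walker (st k) (hist k).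

Lemma histS k : hist k.+1 = hist k ++ [:: p k.*2; p k.*2.+1].
Proof. by rewrite /hist /history doubleS -addn2 iotaD map_cat. Qed.

Lemma good_all k : good k.
Proof.
elim: k => [//|k [cT gw]].
have [[cr ap] wT cnt [eh wt] xw] := good_next_walk cT gw.
have ar : {in reached (wk k), forall u, adjacent (wvertex (wk k)) u}.
  move=> u; rewrite inE => /orP[/eqP->|]; last exact: ap.
  by exists k; apply: maker_moveE.
split.
  move=> t; rewrite /st /= -/(wk k) -/(st k).
  case: ifP => _; first exact: cT.
  rewrite inE => /orP[/eqP->|]; last exact: cT.
  exact: clique_cons.
rewrite /good_walker histS [walker _]/= -/(st k) -/(hist k) -/(wk k).
case: ifP => // va; rewrite [tree _]/= -/(st k) -/(hist k) -/(wk k) va.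
(* A round adds two edges in all while the path grows by one vertex, which preserves the bound. *)
split=> //; rewrite count_cat /= doubleS -addn2 leq_add //.
by rewrite addn0; case: incident; case: incident.
Qed.

Lemma good_wk k : good_walk (st k) (hist k) (wk k).
Proof. by have [] := good_all k; apply: good_next_walk. Qed.

Lemma maker_legal n : ~~ odd n -> legal_move p n.
Proof.
move=> on; have e : n = (n./2).*2 by rewrite even_halfK.
have [_ _ _ [eh wt] _] := good_wk n./2; rewrite e.
rewrite /legal_move maker_moveE; split; first exact: is_edge_mkedge.
move=> i lti ei; case/negP: eh; rewrite -ei.
by apply: map_f; rewrite mem_iota.
Qed.


(** * Recurrent types and children *)

Let arr k := (wtype (wk k), reached (wk k)).

(** The witness is the first arrival of [a] from round [N] on, before which the count cannot
    change. *)
Lemma count_arrival_next a d N : arr (N + d) = a ->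
  exists k, [/\ (N <= k)%N, arr k = a &
    count_mem a (arrivals (st k)) = count_mem a (arrivals (st N))].
Proof.
elim: d N => [|d IH] N; first by rewrite addn0 => e; exists N.
rewrite addnS -addSn; have [e _|/eqP ne] := pselect (arr N = a).
  by exists N.
move=> /IH[k [Nk ek ck]]; exists k; split => //; first exact: ltnW.
by rewrite ck [LHS]/= -/(arr N) (negPf ne).
Qed.

(** For a vertex c with path [q], these [x] form the set X_c. *)
Definition recurrent x q := forall N, exists2 k, (N <= k)%N & arr k = (x, q).

Lemma count_arrival x q m : recurrent x q ->
  exists2 k, arr k = (x, q) & count_mem (x, q) (arrivals (st k)) = m.
Proof.
move=> rxq; elim: m => [|m [k ek ck]].
  have [k _ ek] := rxq 0%N.
  have [k' [_ e c]] := @count_arrival_next _ k 0%N ek.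
  by exists k' => //; rewrite c.
have [k1 kk1 ek1] := rxq k.+1.
have [|k' [_ e c]] := @count_arrival_next (x, q) (k1 - k.+1) k.+1.
  by rewrite subnKC.
by exists k' => //; rewrite c [LHS]/= -/(arr k) ek eqxx ck.
Qed.

Lemma size_arrivals k : size (arrivals (st k)) = k.
Proof. by elim: k => //= k ->. Qed.

Lemma recurrent_aim x q A N : recurrent x q ->
  exists2 k, (N <= k)%N & arr k = (x, q) /\ next_aim (st k) (wk k) = A.
Proof.
move=> rxq; have [m Nm mA] := aim_of_often A N.
have [k ek ck] := count_arrival m rxq.
(* There is one arrival per round, so an arrival preceded by [m] equal ones happens in round [m] or
   later. *)
exists k; first by rewrite (leq_trans Nm) // -ck -[leqRHS]size_arrivals count_size.
by rewrite /next_aim -/(arr k) ek ck.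
Qed.

Lemma tree_mono j k : (j <= k)%N -> {subset tree (st j) <= tree (st k)}.
Proof.
move=> /subnKC <-; elim: (k - j)%N => [|d IH] t; first by rewrite addn0.
move=> /IH; rewrite addnS /=; case: ifP => // _.
by rewrite inE => ->; rewrite orbT.
Qed.

Definition in_tree t := exists k, t \in tree (st k).

Lemma uniform_bound (T : eqType) (A : seq T) (P : T -> nat -> Prop) :
  (forall s m n, (m <= n)%N -> P s m -> P s n) ->
  (forall s, s \in A -> exists n, P s n) -> exists n, forall s, s \in A -> P s n.
Proof.
move=> mono; elim: A => [|a A IH] PA; first by exists 0%N.
have [|n nP] := IH; first by move=> s sA; apply: PA; rewrite inE sA orbT.
have [m mP] := PA a (mem_head _ _).
exists (maxn m n) => s; rewrite inE => /orP[/eqP->|/nP].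
  exact: mono (leq_maxl _ _) mP.
exact: mono (leq_maxr _ _).
Qed.

Lemma tree_bound q (A : seq rat) : (forall s, s \in A -> in_tree (s :: q)) ->
  exists K, forall s, s \in A -> s :: q \in tree (st K).
Proof. by apply: uniform_bound => s m n mn; apply: tree_mono. Qed.

(** Otherwise arrivals of type [x] at the children in [A] cease by some round. A later arrival at
    [q] with aim [A], valid once all these children are in the tree, moves on to one of them: a
    contradiction. *)
Lemma recurrent_child x q (A : seq rat) :
  recurrent x q -> uniq A -> size A = (size q).*2.+1 ->
  (forall s, s \in A -> in_tree (s :: q)) ->
  exists2 s, s \in A & recurrent x (s :: q).
Proof.
move=> rxq uA sA /tree_bound[K AK]; apply: contrapT => nex.
have [|s sin|N HN] := @uniform_bound _ A
  (fun s n => forall k, (n <= k)%N -> arr k <> (x, s :: q)).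
- by move=> s m n mn H k nk; apply: H; apply: leq_trans nk.
- apply: contrapT => nN; apply: nex; exists s => // N.
  apply: contrapT => H; apply: nN; exists N => k Nk e; apply: H.
  by exists k.
have [k] := @recurrent_aim x q A (maxn K N) rxq.
rewrite geq_max => /andP[Kk Nk] [ek aimA].
have eqr : reached (wk k) = q by case: ek.
have ewt : wtype (wk k) = x by case: ek.
have va : valid_aim (tree (st k)) q A.
  rewrite /valid_aim uA sA eqxx; apply/allP => s /AK.
  exact: tree_mono.
have e : walker (st k.+1) = Some (x, wvertex (wk k), q, A).
  by rewrite /= -/(st k) -/(hist k) -/(wk k) aimA eqr va ewt.
have [_] := good_all k.+1; rewrite /good_walker e => -[_ _ cnt _].
have := @head_unblocked _ A (hist k.+1) (size q).*2 uA _ cnt.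
rewrite sA ltnSn => /(_ isT); rewrite mem_filter => /andP[_ hA].
apply: (HN _ hA k.+1); first exact: leqW.
by rewrite /arr /wk /reached /next_walk e.
Qed.

(** While a walker is under way the tree is frozen and its path grows every round; a valid aim is
    nonempty and lies in the tree, so the depth of the tree bounds the walk. *)
Lemma idle_often k : exists2 k', (k <= k')%N & walker (st k') = None.
Proof.
apply: contrapT => nex.
have busy j : tree (st (k + j)) = tree (st k) /\
    exists x w q A, walker (st (k + j)) = Some (x, w, q, A) /\ (j <= size q)%N.
  elim: j => [|j [eT [x [w [q [A [e jq]]]]]]].
    rewrite addn0; split => //; case e: (walker _) => [[[[x w] q] A]|].
      by exists x, w, q, A.
    by case: nex; exists k.
  rewrite addnS; case e': (walker (st (k + j).+1)) => [[[[x' w'] q'] A']|]; last first.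
    by case: nex; exists (k + j).+1 => //; rewrite leqW // leq_addr.
  move: e'; rewrite /= -/(st _) -/(hist _) -/(wk _); case: ifP => // _ [<- <- <- <-].
  split => //; do 4 eexists; split; first by [].
  by rewrite /wk /reached /next_walk e.
pose m := \max_(t <- tree (st k)) size t.
have [eT [x [w [q [A [e mq]]]]]] := busy m.
have [_] := good_all (k + m); rewrite /good_walker e eT => -[_ /and3P[_ + /allP]].
case: A {e} => // s A _ /(_ s (mem_head _ _)) sq _ _.
have sm : (size (s :: q) <= m)%N by apply: leq_bigmax_seq.
by have := leq_trans sm mq; rewrite ltnn.
Qed.

Lemma launches_next d N : walker (st (N + d)) = None ->
  exists k, [/\ (N <= k)%N, walker (st k) = None & launches (st k) = launches (st N)].
Proof.
elim: d N => [|d IH] N; first by rewrite addn0 => e; exists N.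
rewrite addnS -addSn; case e: (walker (st N)) => [a|]; last by exists N.
move=> /IH[k [Nk ek lk]]; exists k; split => //; first exact: ltnW.
by rewrite lk [LHS]/= -/(st N) e.
Qed.

Lemma launched n :
  exists k, [/\ (n <= k)%N, walker (st k) = None & launches (st k) = n].
Proof.
elim: n => [|n [k [nk ek lk]]]; first by exists 0%N.
have [k' kk' ek'] := idle_often k.+1.
have [|k2 [kk2 e2 l2]] := @launches_next (k' - k.+1) k.+1.
  by rewrite subnKC.
exists k2; split => //; first exact: leq_trans kk2.
by rewrite l2 [LHS]/= -/(st k) ek lk.
Qed.

(** Every launch number is reached, and a launched vertex is first joined to the root. *)
Lemma recurrent_root x : recurrent x [:: root].
Proof.
move=> N; have [n Nn <-] := type_of_often x N; have [k [nk e lk]] := launched n.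
exists k; first exact: leq_trans nk.
by rewrite /arr /wk /reached /next_walk e /= lk.
Qed.

Lemma launches_mono j k : (j <= k)%N -> (launches (st j) <= launches (st k))%N.
Proof.
move=> /subnKC <-; elim: (k - j)%N => [|d IH]; first by rewrite addn0.
by rewrite addnS /= (leq_trans IH) //; case: (walker _).
Qed.

Lemma new_child y q b (C : seq rat) : recurrent y q -> y < b ->
  (forall s, s \in C -> in_tree (s :: q)) ->
  exists s, [/\ s \notin C, y < s < b & in_tree (s :: q)].
Proof.
move=> ryq yb /tree_bound[K CK].
have [m ym] : exists m, y + m.+1%:R^-1 < b.
  have d0 : 0 < (b - y)^-1 by rewrite invr_gt0 subr_gt0.
  exists (Num.bound (b - y)^-1); rewrite -ltrBrDl -[ltRHS]invrK.
  rewrite ltf_pV2 ?posrE ?ltr0n //.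
  apply: lt_trans (archi_boundP (ltW d0)) _; by rewrite ltr_nat.
have [M [_ _ lM]] := launched m.+1.
(* The empty aim is never valid, so this arrival stops and becomes a child of [q]. Round [K] makes
   it differ from [C], and round [M] puts it close enough to [y]. *)
have [k] := @recurrent_aim y q [::] (maxn K M) ryq.
rewrite geq_max => /andP[Kk Mk] [ek aimA].
have eqr : reached (wk k) = q by case: ek.
have ewt : wtype (wk k) = y by case: ek.
have [_ wT _ _] := good_wk k; rewrite ewt => /andP[yw wb].
exists (wvertex (wk k)); split.
- apply: contra wT => /CK /(tree_mono Kk) wq; apply/flattenP.
  by exists (wvertex (wk k) :: q) => //; rewrite mem_head.
- rewrite yw (le_lt_trans wb) // (le_lt_trans _ ym) // lerD2l.
  have ml : (m.+1 <= launches (st k.+1))%N by rewrite -lM launches_mono // leqW.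
  by rewrite lef_pV2 ?posrE ?ltr0n ?ler_nat //; apply: leq_trans ml.
- exists k.+1; rewrite /= -/(st k) -/(hist k) -/(wk k) aimA eqr.
  by rewrite /valid_aim /= mem_head.
Qed.

Lemma many_children y q b n : recurrent y q -> y < b ->
  exists C : seq rat, [/\ uniq C, size C = n &
    forall s, s \in C -> y < s < b /\ in_tree (s :: q)].
Proof.
move=> ryq yb; elim: n => [|n [C [uC sC HC]]]; first by exists [::].
have [|s [sC' ysb ts]] := @new_child y q b C ryq yb; first by move=> s /HC[].
exists (s :: C); split => /=; rewrite ?sC' ?sC // => t.
by rewrite inE => /orP[/eqP->|/HC].
Qed.


(** * Building a copy of the rationals along a branch *)

Definition rich_gap q (g : rat * rat) := rich (fun x => recurrent x q /\ g.1 < x < g.2).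

(** Each gap spoils at most [(size q).*2] children: one more, and [recurrent_child] would cover a
    rich set by finitely many sets that are not rich. *)
Lemma many_good_children y q b (G : seq (rat * rat)) n :
  recurrent y q -> y < b -> (forall g, g \in G -> rich_gap q g) ->
  exists C : seq rat, [/\ uniq C, size C = n &
    forall s, s \in C -> [/\ y < s < b, in_tree (s :: q) &
      forall g, g \in G -> rich_gap (s :: q) g]].
Proof.
move=> ryq yb; elim: G n => [|g G IH] n rG.
  have [C [uC sC HC]] := many_children n ryq yb.
  by exists C; split => // s /HC[].
(* The surplus pays for the children that fail at [g]. *)
have [|C [uC sC HC]] := IH (n + (size q).*2)%N.
  by move=> g' g'G; apply: rG; rewrite inE g'G orbT.
pose ok s := `[< rich_gap (s :: q) g >].
have few : (count (predC ok) C <= (size q).*2)%N.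
  rewrite leqNgt -size_filter; apply/negP => big.
  set A := take (size q).*2.+1 (filter (predC ok) C).
  have AC s : s \in A -> s \in C /\ ~~ ok s.
    by move=> /mem_take; rewrite mem_filter => /andP[].
  have [x [xq xg]|s /AC[_ /asboolP]] := @rich_cover _ A
    (fun s x => recurrent x (s :: q) /\ g.1 < x < g.2) _ (rG g (mem_head _ _)).
    have [|||s sA rs] := @recurrent_child x q A xq.
    - by rewrite take_uniq // filter_uniq.
    - by rewrite size_takel.
    - by move=> s /AC[/HC[]].
    by exists s.
  by [].
exists (take n (filter ok C)); split.
- by rewrite take_uniq // filter_uniq.
- rewrite size_takel // size_filter -(leq_add2r (size q).*2) -sC.
  by rewrite -(count_predC ok) leq_add2l.
- move=> s /mem_take; rewrite mem_filter => /andP[/asboolP oks /HC[ysb ts rs]].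
  by split => // g'; rewrite inE => /orP[/eqP->|/rs].
Qed.

(* [L] is a finite increasing map; [(0, 0)] and [(1, 1)] are sentinels, only the
   points of the domain strictly between 0 and 1 are sent to vertices. *)
Record embedding (L : seq (rat * rat)) (q : seq rat) : Prop := Embedding {
  emb_le : {in L &, forall a b, a.1 <= b.1 -> a.2 <= b.2};
  emb_gap : {in L &, forall a b, a.1 < b.1 -> a.2 < b.2 /\ rich_gap q (a.2, b.2)};
  emb_bounds : (0, 0) \in L /\ (1, 1) \in L;
  emb_path : {in L, forall a, 0 < a.1 < 1 -> a.2 \in q};
  emb_clique : clique q }.

Lemma embedding_init : embedding [:: (0, 0); (1, 1)] [:: root].
Proof.
split => //.
- by move=> a b; rewrite !inE => /orP[]/eqP-> /orP[]/eqP-> /=; lra.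
- move=> a b; rewrite !inE => /orP[]/eqP-> /orP[]/eqP-> /=; rewrite ?ltxx //.
  by move=> _; split => //; apply: rich_interval => //; apply: recurrent_root.
- by move=> a; rewrite !inE => /orP[]/eqP->.
- by move=> u v; rewrite !inE => /eqP-> /eqP->; rewrite eqxx.
Qed.

Lemma clique_in_tree t : in_tree t -> clique t.
Proof. by case=> k; have [+ _] := good_all k => /[apply]. Qed.

Lemma embedding_extend L q e : embedding L q -> 0 < e < 1 ->
  exists L' q', [/\ embedding L' q', {subset L <= L'} & exists v, (e, v) \in L'].
Proof.
move=> [Lle Lgap [L0 L1] Lq cq] /andP[e0 e1].
have [[v ev]|enew] := pselect (exists v, (e, v) \in L).
  by exists L, q; split => //; exists v.
have ne a : a \in L -> a.1 != e.
  by case: a => x v aL; apply/eqP => /= xe; apply: enew; exists v; rewrite -xe.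
(* [lo] and [hi] are the neighbours of [e] in the domain; the sentinels guarantee that both
   exist. *)
have [|lo] := @seq_argmax _ fst (filter (fun a : rat * rat => a.1 < e) L) (0, 0).
  by rewrite mem_filter e0.
rewrite mem_filter => /andP[loe loL] lomax.
have [|hi] := @seq_argmax _ (fun a => - a.1)
  (filter (fun a : rat * rat => e < a.1) L) (1, 1).
  by rewrite mem_filter e1.
rewrite mem_filter => /andP[ehi hiL] himin.
have [lohi] := Lgap _ _ loL hiL (lt_trans loe ehi).
move=> /rich_split[y [b [yq /andP[loy yb] bhi richL richR]]].
have below a : a \in L -> a.1 < e -> a.2 <= lo.2.
  by move=> aL ae; apply: Lle => //; apply: lomax; rewrite mem_filter ae.
have above a : a \in L -> e < a.1 -> hi.2 <= a.2.
  move=> aL ea; apply: Lle => //; rewrite -lerN2; apply: himin.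
  by rewrite mem_filter ea.
(* The value at [e] will be some [s] between [y] and [b], not known yet. Using [b] for it as a left
   end and [y] as a right end makes every gap in [G] fit inside the corresponding final gap. *)
pose A := (e, b) :: L; pose B := (e, y) :: L.
pose G := [seq (c.1.2, c.2.2) | c <- [seq (a, a') | a <- A, a' <- B] & c.1.1 < c.2.1].
have GP a a' : a \in A -> a' \in B -> a.1 < a'.1 -> (a.2, a'.2) \in G.
  move=> aA aB lt; apply/mapP; exists (a, a') => //; rewrite mem_filter lt.
  exact: allpairs_f.
have [|C [_ sC HC]] := @many_good_children y q b G 1 yq yb.
  move=> g /mapP[c]; rewrite mem_filter => /andP[lt /allpairsP[[a a'] /= [aA a'B ec]]] ->.
  move: aA a'B lt; rewrite {c}ec /= !inE => /orP[/eqP->|aL] /orP[/eqP->|a'L] /=.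
  - by rewrite ltxx.
  - move=> /(above _ a'L) le; apply: rich_sub richR => x [? /andP[-> xhi]].
    by rewrite (lt_le_trans xhi le).
  - move=> /(below _ aL) le; apply: rich_sub richL => x [? /andP[lox ->]].
    by rewrite (le_lt_trans le lox).
  - by case/(Lgap _ _ aL a'L).
case: C sC HC => // s C _ /(_ s (mem_head _ _)) [/andP[ys sb] ts rs].
have low a : a \in L -> a.1 < e -> a.2 < s.
  by move=> aL /(below _ aL) le; rewrite (le_lt_trans le) // (lt_trans loy).
have high a : a \in L -> e < a.1 -> s < a.2.
  by move=> aL /(above _ aL) le; rewrite (lt_le_trans _ le) // (lt_trans sb).
exists ((e, s) :: L), (s :: q); split; last first.
- by exists s; rewrite mem_head.
- by move=> a aL; rewrite inE aL orbT.
split.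
- move=> a a'; rewrite !inE => /orP[/eqP->|aL] /orP[/eqP->|a'L] //=.
  + by rewrite le_eqVlt eq_sym (negPf (ne _ a'L)) => /(high _ a'L)/ltW.
  + by rewrite le_eqVlt (negPf (ne _ aL)) => /(low _ aL)/ltW.
  + exact: Lle.
- move=> a a'; rewrite !inE => /orP[/eqP->|aL] /orP[/eqP->|a'L] /= lt.
  + by rewrite ltxx in lt.
  + split; first exact: high.
    have := rs _ (GP (e, b) a' (mem_head _ _) _ lt); rewrite inE a'L orbT.
    move=> /(_ isT); apply: rich_sub => x /= [? /andP[bx ->]].
    by rewrite (lt_trans sb bx).
  + split; first exact: low.
    have := rs _ (GP a (e, y) _ (mem_head _ _) lt); rewrite inE aL orbT.
    move=> /(_ isT); apply: rich_sub => x /= [? /andP[-> xy]].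
    by rewrite (lt_trans xy ys).
  + split; first by case: (Lgap _ _ aL a'L lt).
    by apply: rs; apply: GP; rewrite // inE ?aL ?a'L orbT.
- by rewrite !inE L0 L1 !orbT.
- move=> a; rewrite !inE => /orP[/eqP->|aL] /=; first by rewrite eqxx.
  by move=> /(Lq _ aL) ->; rewrite orbT.
- exact: clique_in_tree.
Qed.

Lemma maker_wins_play : maker_wins p.
Proof.
pose E := {Lq : seq (rat * rat) * seq rat | embedding Lq.1 Lq.2}.
have ext (c : E * rat) : exists c' : E,
    {subset (sval c.1).1 <= (sval c').1} /\
    exists v, (squash c.2, v) \in (sval c').1.
  case: c => [[[L q] /= em] x].
  have [L' [q' [em' sub ex]]] := embedding_extend em (squash_bounds x).
  by exists (exist _ (L', q') em').
have [next nextP] := choice ext.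
(* Stage [n'.+1] treats the rational with code [n']; the default 0 covers numbers that are not
   codes. *)
pose emb := fix emb n : E := if n is n'.+1 then
  next (emb n', odflt 0 (unpickle n')) else exist _ (_, _) embedding_init.
have embS n : emb n.+1 = next (emb n, odflt 0 (unpickle n)) by [].
have emb_mono m n : (m <= n)%N -> {subset (sval (emb m)).1 <= (sval (emb n)).1}.
  move=> /subnKC <-; elim: (n - m)%N => [|d IH] a; first by rewrite addn0.
  move=> /IH; rewrite addnS embS.
  by have [+ _] := nextP (emb (m + d), odflt 0 (unpickle (m + d))); apply.
have ex x : exists v, exists n, (squash x, v) \in (sval (emb n)).1.
  have [_ [v vP]] := nextP (emb (pickle x), x); exists v, (pickle x).+1.
  by rewrite embS pickleK.
have [f fP] := choice ex.
(* The stages increase, so any two chosen values occur together in one stage, where the order and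
   clique conditions apply. *)
have common x y : exists n, let em := sval (emb n) in
    (squash x, f x) \in em.1 /\ (squash y, f y) \in em.1.
  have [m mP] := fP x; have [n nP] := fP y; exists (maxn m n); split.
    exact: emb_mono (leq_maxl _ _) _ mP.
  exact: emb_mono (leq_maxr _ _) _ nP.
exists (fun v => exists a, f a = v), f; split.
  move=> a b ab; have [n [an bn]] := common a b.
  by have [] := emb_gap (svalP (emb n)) an bn (squash_lt ab).
split=> [//|_ _ [a <-] [b <-] lt].
have [n [an bn]] := common a b; have em := svalP (emb n).
have [] := emb_clique em (emb_path em an (squash_bounds a))
  (emb_path em bn (squash_bounds b)) _; first by rewrite lt_eqF.
by move=> k e; exists k.*2; rewrite odd_double e mkedge_lt.
Qed.

End Play.

Theorem theorem1p3 : exists s : maker_strategy, winning_maker_strategy s.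
Proof.
exists strategy => p fp _; split; first by move=> n; apply: maker_legal.
exact: maker_wins_play.
Qed.
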